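(* Let $U$ be a set of nonrecursive functions $\mathbb{N}\to\mathbb{N}$. If $U$ is discrete as a subspace of $\mathcal{K}_2$, then the tripos $[-,\mathcal{P}(\Pi)^U_{\mathcal{K}_2,\mathrm{Rec}}]$ is non-localic.
   Context: The filtered pca $(\mathcal{K}_2,\mathrm{Rec})$. $\mathcal{K}_2$ is the set of functions $\mathbb{N}\to\mathbb{N}$, with the topology whose basic open sets are $V_\sigma=\{\alpha\mid\alpha(0)=\sigma_0,\dots,\alpha(n)=\sigma_n\}$ for finite sequences $\sigma=(\sigma_0,\dots,\sigma_n)$. Fix a computable coding $[\ldots]$ of finite sequences of natural numbers. For $\alpha,\beta\in\mathcal{K}_2$ write $\alpha\beta(n)=k$ if there is $N$ with $\alpha([n,\beta(0),\dots,\beta(N-1)])=k+1$ and $\alpha([n,\beta(0),\dots,\beta(l-1)])=0$ for all $l<N$. The application $\alpha\beta$ is defined iff for each $n$ there is $k$ with $\alpha\beta(n)=k$, and is then the corresponding function. This is a partial combinatory algebra, i.e. it has $\mathsf{k},\mathsf{s}$ with $\mathsf{k}xy=x$, $\mathsf{s}xy$ always defined, and $\mathsf{s}xyz=xz(yz)$ whenever the latter is defined; it is regarded as an ordered pca with the discrete order. $\mathrm{Rec}$ is the set of total recursive functions; it is closed under defined application and contains choices for $\mathsf{k},\mathsf{s}$ (it is a filter). Put $A=\mathcal{K}_2$, $A'=\mathrm{Rec}$. Application associates to the left. For an application term $t$ in variables $x_1,\dots,x_n$ with constants from $A$, $\langle x_1\cdots x_n\rangle t$ denotes an element of $A$ (in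 $A'$ if the constants are in $A'$) such that $(\langle x_1\cdots x_n\rangle t)a_1\cdots a_{n-1}$ is always defined and $(\langle x_1\cdots x_n\rangle t)a_1\cdots a_n=t[a_1,\dots,a_n]$ whenever the latter is defined. Sequence coding. Fix numerals $\bar{n}\in A'$, a coding of finite sequences of elements of $A$ by elements $[a_0,\dots,a_{n-1}]\in A$, and $\mathsf{b},\mathsf{c},\mathsf{d},\mathsf{t}\in A'$ with $\mathsf{b}\bar{n}[a_0,\dots,a_k]=a_n$ for $n\leq k$; $\mathsf{c}\bar{n}[a_0,\dots,a_k]=[a_n,\dots,a_k]$ for $n\leq k+1$ (the empty sequence if $n=k+1$); $\mathsf{d}a[a_0,\dots,a_{n-1}]=[a,a_0,\dots,a_{n-1}]$; $\mathsf{t}a=[a]$. Write $\pi_i=\mathsf{b}\bar{i}\pi$, $\pi_{\geq j}=\mathsf{c}\bar{j}\pi$. The abstract Krivine structure determined by $(A,A')$ and $U$ (where $U\cap A'=\emptyset$): terms $\Lambda=A$; quasi-proofs $\mathsf{QP}=A'$; stacks $\Pi=$ the set of coded sequences; push operation $a.\pi=\mathsf{d}a\pi$ (associated to the right); $a\cdot b=Mab$ with $M=\langle xy\pi\rangle x(\mathsf{d}y\pi)\in A'$ (so $a\cdot b$ is $\langle\pi\rangle a(b.\pi)$); $k_\pi=\kappa\pi$ with $\kappa=\langle\pi\rho\rangle\rho_0\pi\in A'$; $\mathsf{K}=\langle\pi\rangle\pi_0\pi_{\geq2}$, $\mathsf{S}=\langle\pi\rangle((\pi_0\cdot\pi_2)\cdot(\pi_1\cdot\pi_2))\pi_{\geq3}$,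 $\mathsf{cc}=\langle\pi\rangle\pi_0(k_{\pi_{\geq1}}.\pi_{\geq1})$; pole $\perp\!\!\!\perp\ =\{(t,\pi)\in A\times\Pi\mid t\pi\text{ is defined and }t\pi\in U\}$. The tripos. For $V\subseteq\Lambda$ let $V^{\perp\!\!\!\perp}=\{\pi\in\Pi\mid\forall t\in V\,(t,\pi)\in\perp\!\!\!\perp\}$; for $\alpha\subseteq\Pi$ let $|\alpha|=\alpha^{\perp\!\!\!\perp}=\{t\in\Lambda\mid\forall\pi\in\alpha\,(t,\pi)\in\perp\!\!\!\perp\}$. $\mathcal{P}(\Pi)^U_{\mathcal{K}_2,\mathrm{Rec}}$ is the set $\{\beta\subseteq\Pi\mid(\beta^{\perp\!\!\!\perp})^{\perp\!\!\!\perp}=\beta\}$ ordered by reverse inclusion, with total application $\alpha\bullet\beta=(X^{\perp\!\!\!\perp})^{\perp\!\!\!\perp}$, where $X=\{\pi\in\Pi\mid\forall t\in|\alpha|\,\forall s\in|\beta|\ (t,s.\pi)\in\perp\!\!\!\perp\}$, and filter $\Phi=\{\alpha\mid|\alpha|\cap\mathsf{QP}\neq\emptyset\}$. The tripos $[-,\mathcal{P}(\Pi)^U_{\mathcal{K}_2,\mathrm{Rec}}]$ assigns to a set $I$ the set of functions $I\to\mathcal{P}(\Pi)^U_{\mathcal{K}_2,\mathrm{Rec}}$, with $\phi\leq\psi$ iff there is $\alpha\in\Phi$ such that $\alpha\bullet\phi(i)\leq\psi(i)$ for all $i\in I$. A tripos is localic if it is equivalent, as a Set-indexed preorder, to the tripos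 $I\mapsto H^I$ (with pointwise order) for some locale (complete Heyting algebra) $H$.
   Formalization: The set U is additionally assumed nonempty: for empty U, which is vacuously a discrete set of nonrecursive functions, the pole is empty and the tripos is I ↦ 2^I, which is localic, so the claim fails. *)

(* Defs.v *)
From Stdlib Require Import Arith Lia List.
From Stdlib Require Import FunctionalExtensionality ClassicalEpsilon.
Import ListNotations.

(** * Recursive functions *)

(* Programs for partial recursive functions (Kleene's schemes).  Arities are
   not tracked by the type: a program applied to an argument list of an
   unsuitable length has no value. *)
Inductive prog : Type :=
| Zero : prog
| Succ : prog
| Proj : nat -> prog
| Comp : prog -> list prog -> prog
| Prec : prog -> prog -> prog
| Mu : prog -> prog.

Inductive computes : prog -> list nat -> nat -> Prop :=
| computes_zero v : computes Zero v 0
| computes_succ x : computes Succ [x] (S x)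
| computes_proj i v x : nth_error v i = Some x -> computes (Proj i) v x
| computes_comp p qs v ys z :
    Forall2 (fun q y => computes q v y) qs ys ->
    computes p ys z -> computes (Comp p qs) v z
| computes_prec0 p q v y : computes p v y -> computes (Prec p q) (0 :: v) y
| computes_precS p q n v y z :
    computes (Prec p q) (n :: v) y -> computes q (n :: y :: v) z ->
    computes (Prec p q) (S n :: v) z
| computes_mu p v y :
    computes p (y :: v) 0 ->
    (forall x, x < y -> exists k, computes p (x :: v) (S k)) ->
    computes (Mu p) v y.

Definition recursive (f : nat -> nat) : Prop :=
  exists p, forall n, computes p [n] (f n).

Definition recursive2 (f : nat -> nat -> nat) : Prop :=
  exists p, forall m n, computes p [m; n] (f m n).

Record seq_coding : Type := {
  code :> list nat -> nat;
  code_range :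
    exists f, recursive f /\ forall e, f e = 0 <-> exists l, e = code l;
  code_length :
    exists f, recursive f /\ forall l, f (code l) = length l;
  code_entry :
    exists f, recursive2 f /\ forall l i, f (code l) i = nth i l 0;
  code_snoc :
    exists f, recursive2 f /\ forall l x, code (l ++ [x]) = f (code l) x
}.

(** * The space and the partial applicative structure K2 *)

Definition K2 : Type := nat -> nat.

Definition initial (alpha : K2) (n : nat) : list nat := map alpha (seq 0 n).

Definition basic_open (sigma : list nat) (alpha : K2) : Prop :=
  initial alpha (length sigma) = sigma.

Definition K2_open (O : K2 -> Prop) : Prop :=
  forall alpha, O alpha ->
  exists sigma, basic_open sigma alpha /\
    forall beta, basic_open sigma beta -> O beta.

(* Every subset of [U] is open in the subspace topology. *)
Definition discrete_subspace (U : K2 -> Prop) : Prop :=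
  forall S : K2 -> Prop, (forall alpha, S alpha -> U alpha) ->
  exists O, K2_open O /\ forall alpha, S alpha <-> O alpha /\ U alpha.

(* [papp C alpha beta gamma]: the application of alpha to beta is defined and
   equal to gamma. *)
Definition papp (C : seq_coding) (alpha beta gamma : K2) : Prop :=
  forall n, exists N,
    alpha (C (n :: initial beta N)) = gamma n + 1 /\
    forall l, l < N -> alpha (C (n :: initial beta l)) = 0.

Inductive term : Type :=
| Var : nat -> term
| Cst : K2 -> term
| App : term -> term -> term.

Fixpoint vars_below (n : nat) (t : term) : Prop :=
  match t with
  | Var i => i < n
  | Cst _ => True
  | App t u => vars_below n t /\ vars_below n u
  end.

Fixpoint constants_in (P : K2 -> Prop) (t : term) : Prop :=
  match t with
  | Var _ => True
  | Cst a => P a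
  | App t u => constants_in P t /\ constants_in P u
  end.

(* [denotes C rho t v]: under the assignment [Var i |-> nth i rho], the term
   [t] is defined and has value [v]. *)
Fixpoint denotes (C : seq_coding) (rho : list K2) (t : term) (v : K2) : Prop :=
  match t with
  | Var i => nth_error rho i = Some v
  | Cst a => a = v
  | App t u =>
      exists a b, denotes C rho t a /\ denotes C rho u b /\ papp C a b v
  end.

Definition apps (a : K2) (l : list K2) : term :=
  fold_left (fun t b => App t (Cst b)) l (Cst a).

(* The value of a closed term, when it is defined. *)
Definition value (C : seq_coding) (t : term) : K2 :=
  epsilon (inhabits (fun _ => 0)) (denotes C [] t).

(* [abs n t] is <x_1 ... x_n>t, where x_i is [Var (i-1)]; the other fields are
   the numerals, the coding of finite sequences, and b, c, d, t. *)
Record combinators (C : seq_coding) : Type := {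
  abs : nat -> term -> K2;
  abs_defined : forall n t l,
    vars_below (S n) t -> length l = n ->
    exists v, denotes C [] (apps (abs (S n) t) l) v;
  abs_value : forall n t l v,
    vars_below (S n) t -> length l = S n -> denotes C l t v ->
    denotes C [] (apps (abs (S n) t) l) v;
  abs_recursive : forall n t,
    vars_below (S n) t -> constants_in recursive t -> recursive (abs (S n) t);
  num : nat -> K2;
  num_recursive : forall n, recursive (num n);
  cseq : list K2 -> K2;
  cb : K2;
  cc : K2;
  cd : K2;
  ct : K2;
  cb_recursive : recursive cb;
  cc_recursive : recursive cc;
  cd_recursive : recursive cd;
  ct_recursive : recursive ct;
  cb_value : forall n l a, nth_error l n = Some a ->
    denotes C [] (apps cb [num n; cseq l]) a;
  cc_value : forall n l, l <> [] -> n <= length l ->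
    denotes C [] (apps cc [num n; cseq l]) (cseq (skipn n l));
  cd_value : forall a l, denotes C [] (apps cd [a; cseq l]) (cseq (a :: l));
  ct_value : forall a, denotes C [] (apps ct [a]) (cseq [a])
}.

(** * Abstract Krivine structures *)

Record krivine_structure : Type := {
  lam : Type;
  stack : Type;
  kapp : lam -> lam -> lam;
  push : lam -> stack -> stack;
  kcont : stack -> lam;
  combK : lam;
  combS : lam;
  callcc : lam;
  QP : lam -> Prop;
  pole : lam -> stack -> Prop;
  QP_K : QP combK;
  QP_S : QP combS;
  QP_callcc : QP callcc;
  QP_app : forall t s, QP t -> QP s -> QP (kapp t s);
  pole_app : forall t s p, pole t (push s p) -> pole (kapp t s) p;
  pole_K : forall t s p, pole t p -> pole combK (push t (push s p));
  pole_S : forall t s u p, pole (kapp (kapp t u) (kapp s u)) p ->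
    pole combS (push t (push s (push u p)));
  pole_callcc : forall t p,
    pole t (push (kcont p) p) -> pole callcc (push t p);
  pole_kcont : forall t p q, pole t p -> pole (kcont p) (push t q)
}.

Section KrivineOPCA.
Context (A : krivine_structure).

Definition orth_terms (V : lam A -> Prop) (p : stack A) : Prop :=
  forall t, V t -> pole A t p.

Definition orth_stacks (alpha : stack A -> Prop) (t : lam A) : Prop :=
  forall p, alpha p -> pole A t p.

Definition biorth (alpha : stack A -> Prop) : stack A -> Prop :=
  orth_terms (orth_stacks alpha).

Record closed_set : Type := {
  cset :> stack A -> Prop;
  cset_closed : forall p, biorth cset p <-> cset p
}.

Definition cle (alpha beta : closed_set) : Prop :=
  forall p, beta p -> alpha p.

Lemma biorth_incl (X : stack A -> Prop) p : X p -> biorth X p.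
Proof. intros HX t Ht. now apply Ht. Qed.

Lemma orth_biorth (X : stack A -> Prop) t :
  orth_stacks X t -> orth_stacks (biorth X) t.
Proof. intros Ht p Hp. now apply Hp. Qed.

Lemma biorth_closed (X : stack A -> Prop) p :
  biorth (biorth X) p <-> biorth X p.
Proof.
  split.
  - intros H t Ht. apply H. now apply orth_biorth.
  - apply biorth_incl.
Qed.

Definition closure (X : stack A -> Prop) : closed_set :=
  {| cset := biorth X; cset_closed := biorth_closed X |}.

Definition bullet (alpha beta : closed_set) : closed_set :=
  closure (fun p => forall t s,
    orth_stacks alpha t -> orth_stacks beta s -> pole A t (push A s p)).

Definition Phi (alpha : closed_set) : Prop :=
  exists t, orth_stacks alpha t /\ QP A t.

Definition tripos_le (I : Type) (phi psi : I -> closed_set) : Prop :=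
  exists alpha, Phi alpha /\ forall i, cle (bullet alpha (phi i)) (psi i).

Lemma bullet_realizer (alpha beta : closed_set) t s :
  orth_stacks alpha t -> orth_stacks beta s ->
  orth_stacks (bullet alpha beta) (kapp A t s).
Proof.
  intros Ht Hs. apply orth_biorth. intros p Hp.
  apply pole_app. now apply Hp.
Qed.

Lemma tripos_le_of_realizer (I : Type) (phi psi : I -> closed_set) r :
  QP A r ->
  (forall i s p, orth_stacks (phi i) s -> psi i p -> pole A r (push A s p)) ->
  tripos_le I phi psi.
Proof.
  intros Hr H.
  exists (closure (orth_terms (eq r))). split.
  - exists r. split; [|exact Hr].
    apply orth_biorth. intros p Hp. now apply Hp.
  - intros i p Hp. apply biorth_incl. intros t s Ht Hs.
    apply Ht, biorth_incl. intros r' <-. now apply (H i).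
Qed.

Definition combI : lam A := kapp A (kapp A (combS A) (combK A)) (combK A).

Lemma QP_I : QP A combI.
Proof. repeat apply QP_app; auto using QP_S, QP_K. Qed.

Lemma pole_I t p : pole A t p -> pole A combI (push A t p).
Proof.
  intros H. do 2 apply pole_app. apply pole_S.
  do 2 apply pole_app. now apply pole_K.
Qed.

Lemma tripos_le_refl (I : Type) (phi : I -> closed_set) : tripos_le I phi phi.
Proof.
  apply (tripos_le_of_realizer _ _ _ combI QP_I).
  intros i s p Hs Hp. now apply pole_I, Hs.
Qed.

Lemma tripos_le_trans (I : Type) (phi psi chi : I -> closed_set) :
  tripos_le I phi psi -> tripos_le I psi chi -> tripos_le I phi chi.
Proof.
  intros (a & (t & Ht & Qt) & Ha) (b & (s & Hs & Qs) & Hb).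
  set (eta_s := kapp A (kapp A (combS A) (kapp A (combK A) combI)) s).
  apply (tripos_le_of_realizer _ _ _
           (kapp A (kapp A (combS A) (kapp A (combK A) eta_s)) t)).
  - repeat apply QP_app; auto using QP_S, QP_K, QP_I.
  - intros i u p Hu Hp. do 2 apply pole_app. apply pole_S.
    do 3 apply pole_app. apply pole_K.
    do 2 apply pole_app. apply pole_S.
    do 3 apply pole_app. apply pole_K, pole_I.
    apply (bullet_realizer b (psi i)); [exact Hs| |now apply Hb].
    intros q Hq. apply (bullet_realizer a (phi i)); auto. now apply Ha.
Qed.

End KrivineOPCA.

(** * Set-indexed preorders and localic triposes *)

Record indexed_preorder : Type := {
  fiber :> Type -> Type;
  fle : forall I, fiber I -> fiber I -> Prop;
  reindex : forall I J, (J -> I) -> fiber I -> fiber J;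
  fle_refl : forall I x, fle I x x;
  fle_trans : forall I x y z, fle I x y -> fle I y z -> fle I x z;
  reindex_mono : forall I J (f : J -> I) x y,
    fle I x y -> fle J (reindex I J f x) (reindex I J f y);
  reindex_id : forall I x, reindex I I (fun i => i) x = x;
  reindex_comp : forall I J K (f : J -> I) (g : K -> J) x,
    reindex I K (fun k => f (g k)) x = reindex J K g (reindex I J f x)
}.

Definition fiso (P : indexed_preorder) (I : Type) (x y : P I) : Prop :=
  fle P I x y /\ fle P I y x.

Record indexed_map (P Q : indexed_preorder) : Type := {
  imap :> forall I, P I -> Q I;
  imap_mono : forall I x y, fle P I x y -> fle Q I (imap I x) (imap I y);
  imap_natural : forall I J (f : J -> I) x,
    fiso Q J (imap J (reindex P I J f x)) (reindex Q I J f (imap I x))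
}.

Definition equivalent (P Q : indexed_preorder) : Prop :=
  exists (F : indexed_map P Q) (G : indexed_map Q P),
    (forall I x, fiso P I (G I (F I x)) x) /\
    (forall I y, fiso Q I (F I (G I y)) y).

(* Complete Heyting algebras; all infima exist because all suprema do. *)
Record locale : Type := {
  opens :> Type;
  lle : opens -> opens -> Prop;
  lle_refl : forall x, lle x x;
  lle_trans : forall x y z, lle x y -> lle y z -> lle x z;
  lle_antisym : forall x y, lle x y -> lle y x -> x = y;
  lsup : (opens -> Prop) -> opens;
  lsup_lub : forall S y, lle (lsup S) y <-> forall x, S x -> lle x y;
  lmeet : opens -> opens -> opens;
  lmeet_glb : forall x y z, lle z (lmeet x y) <-> lle z x /\ lle z y;
  limp : opens -> opens -> opens;
  limp_adj : forall x y z, lle z (limp x y) <-> lle (lmeet z x) y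
}.

Definition locale_tripos (H : locale) : indexed_preorder.
Proof.
  refine {| fiber := fun I => I -> H;
            fle := fun I x y => forall i, lle H (x i) (y i);
            reindex := fun I J f x j => x (f j) |}; try now auto.
  - intros I x i. apply lle_refl.
  - intros I x y z Hxy Hyz i. now apply lle_trans with (y i).
Defined.

Definition localic (P : indexed_preorder) : Prop :=
  exists H : locale, equivalent P (locale_tripos H).

Definition krivine_tripos (A : krivine_structure) : indexed_preorder.
Proof.
  refine {| fiber := fun I => I -> closed_set A;
            fle := tripos_le A;
            reindex := fun I J f x j => x (f j) |}; auto.
  - apply tripos_le_refl.
  - apply tripos_le_trans.
  - intros I J f x y (a & Ha & H). now exists a.
Defined.

(** * The Krivine structure determined by (K2, Rec) and U *)

Lemma papp_fun (C : seq_coding) a b c c' :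
  papp C a b c -> papp C a b c' -> c = c'.
Proof.
  intros H H'. apply functional_extensionality. intros n.
  destruct (H n) as (N & HN & HlN), (H' n) as (N' & HN' & HlN').
  destruct (lt_eq_lt_dec N N') as [[HNN|HNN]|HNN].
  - rewrite (HlN' _ HNN) in HN. lia.
  - subst N'. lia.
  - rewrite (HlN _ HNN) in HN'. lia.
Qed.

Lemma denotes_fun (C : seq_coding) rho t v v' :
  denotes C rho t v -> denotes C rho t v' -> v = v'.
Proof.
  revert v v'. induction t as [i|a|t IHt u IHu]; simpl; intros v v'.
  - congruence.
  - congruence.
  - intros (a & b & Ha & Hb & H) (a' & b' & Ha' & Hb' & H').
    rewrite <- (IHt _ _ Ha Ha'), <- (IHu _ _ Hb Hb') in H'.
    now apply (papp_fun C a b).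
Qed.

Lemma value_denotes (C : seq_coding) t v : denotes C [] t v -> value C t = v.
Proof.
  intros H. apply (denotes_fun C [] t); [|exact H].
  unfold value. apply epsilon_spec. now exists v.
Qed.

Lemma initial_S (a : K2) n : initial a (S n) = initial a n ++ [a n].
Proof. unfold initial. now rewrite seq_S, map_app. Qed.

Lemma recursive_papp (C : seq_coding) a b c :
  recursive a -> recursive b -> papp C a b c -> recursive c.
Proof.
  intros [p Hp] [q Hq] Hc.
  destruct (code_snoc C) as (f & [r Hr] & Hf).
  assert (Hnil : exists z, forall v, computes z v (C [])).
  { induction (C []) as [|k [z IHz]].
    - exists Zero. constructor.
    - exists (Comp Succ [z]). intros v.
      econstructor; [repeat constructor; apply IHz|constructor]. }
  destruct Hnil as [z Hz].
  set (g := Prec (Comp r [z; Proj 0]) (Comp r [Proj 1; Comp q [Proj 0]])).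
  assert (Hg : forall N n, computes g [N; n] (C (n :: initial b N))).
  { induction N as [|N IHN]; intros n.
    - apply computes_prec0.
      change (C (n :: initial b 0)) with (C ([] ++ [n])). rewrite Hf.
      econstructor; [|apply Hr].
      repeat constructor; auto.
    - eapply computes_precS; [apply IHN|].
      rewrite initial_S, app_comm_cons, Hf.
      econstructor; [|apply Hr].
      repeat constructor. econstructor; [repeat constructor|apply Hq]. }
  set (pg := Comp p [g]).
  assert (Hpg : forall N n, computes pg [N; n] (a (C (n :: initial b N)))).
  { intros N n. econstructor; [|apply Hp]. repeat constructor. apply Hg. }
  set (nz := Comp (Prec (Comp Succ [Zero]) Zero) [pg]).
  assert (Hsg : forall k, computes (Prec (Comp Succ [Zero]) Zero) [k]
                            (match k with 0 => 1 | S _ => 0 end)).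
  { assert (Hsg : forall k, exists y,
        computes (Prec (Comp Succ [Zero]) Zero) [k] y).
    { induction k as [|k [y IHk]].
      - exists 1. apply computes_prec0.
        econstructor; [repeat constructor|constructor].
      - exists 0. eapply computes_precS; [apply IHk|constructor]. }
    intros [|k].
    - apply computes_prec0. econstructor; [repeat constructor|constructor].
    - destruct (Hsg k) as [y Hy].
      eapply computes_precS; [apply Hy|constructor]. }
  assert (Hnz : forall N n, computes nz [N; n]
    (match a (C (n :: initial b N)) with 0 => 1 | S _ => 0 end)).
  { intros N n. econstructor; [|apply Hsg]. repeat constructor. apply Hpg. }
  set (prd := Prec Zero (Proj 0)).
  assert (Hprd : forall k, computes prd [k] (pred k)).
  { induction k as [|k IHk].
    - apply computes_prec0. constructor.
    - eapply computes_precS; [apply IHk|now constructor]. }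
  exists (Comp prd [Comp pg [Mu nz; Proj 0]]). intros n.
  destruct (Hc n) as (N & HN & HlN).
  replace (c n) with (pred (a (C (n :: initial b N)))) by lia.
  econstructor; [|apply Hprd].
  repeat constructor. econstructor; [|apply Hpg].
  repeat constructor.
  - specialize (Hnz N n). rewrite HN, Nat.add_1_r in Hnz. exact Hnz.
  - intros l Hl. exists 0. specialize (Hnz l n).
    now rewrite (HlN l Hl) in Hnz.
Qed.

Section KrivineK2.
Context (C : seq_coding) (D : combinators C).

Definition K2_stack : Type := {p : K2 | exists l, p = cseq C D l}.

(* [at_ i p] and [from_ j p] are p_i and p_{>= j}; [dot_ a p] is a.p and
   [mul_ a b] is M a b. *)
Definition at_ (i : nat) (p : term) : term :=
  App (App (Cst (cb C D)) (Cst (num C D i))) p.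

Definition from_ (j : nat) (p : term) : term :=
  App (App (Cst (cc C D)) (Cst (num C D j))) p.

Definition dot_ (a p : term) : term := App (App (Cst (cd C D)) a) p.

Definition K2_M : K2 := abs C D 3 (App (Var 0) (dot_ (Var 1) (Var 2))).

Definition mul_ (a b : term) : term := App (App (Cst K2_M) a) b.

Definition K2_kappa : K2 := abs C D 2 (App (at_ 0 (Var 1)) (Var 0)).

Definition K2_K : K2 := abs C D 1 (App (at_ 0 (Var 0)) (from_ 2 (Var 0))).

Definition K2_S : K2 :=
  abs C D 1 (App (mul_ (mul_ (at_ 0 (Var 0)) (at_ 2 (Var 0)))
                       (mul_ (at_ 1 (Var 0)) (at_ 2 (Var 0))))
                 (from_ 3 (Var 0))).

Definition K2_cc : K2 :=
  abs C D 1 (App (at_ 0 (Var 0))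
                 (dot_ (App (Cst K2_kappa) (from_ 1 (Var 0)))
                       (from_ 1 (Var 0)))).

Definition K2_app (a b : K2) : K2 := value C (apps K2_M [a; b]).

Definition K2_cont (p : K2_stack) : K2 :=
  value C (apps K2_kappa [proj1_sig p]).

Lemma K2_push_stack (a : K2) (p : K2_stack) :
  exists l, value C (apps (cd C D) [a; proj1_sig p]) = cseq C D l.
Proof.
  destruct p as [p [l ->]]. exists (a :: l).
  apply value_denotes, cd_value.
Qed.

Definition K2_push (a : K2) (p : K2_stack) : K2_stack :=
  exist _ (value C (apps (cd C D) [a; proj1_sig p])) (K2_push_stack a p).

Definition K2_pole (U : K2 -> Prop) (t : K2) (p : K2_stack) : Prop :=
  exists u, papp C t (proj1_sig p) u /\ U u.

Lemma K2_push_cseq a (p : K2_stack) l :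
  proj1_sig p = cseq C D l -> proj1_sig (K2_push a p) = cseq C D (a :: l).
Proof. simpl. intros ->. apply value_denotes, cd_value. Qed.

Lemma denotes_at rho i x l a :
  denotes C rho x (cseq C D l) -> nth_error l i = Some a ->
  denotes C rho (at_ i x) a.
Proof.
  intros Hx Hi.
  destruct (cb_value C D _ _ _ Hi) as (u & v & Hu & Hv & H).
  destruct Hu as (u1 & u2 & <- & <- & Hu). simpl in Hv; subst v.
  exists u, (cseq C D l). repeat split; auto.
  exists (cb C D), (num C D i). now repeat split.
Qed.

Lemma denotes_from rho j x l :
  denotes C rho x (cseq C D l) -> l <> [] -> j <= length l ->
  denotes C rho (from_ j x) (cseq C D (skipn j l)).
Proof.
  intros Hx Hl Hj.
  destruct (cc_value C D _ _ Hl Hj) as (u & v & Hu & Hv & H).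
  destruct Hu as (u1 & u2 & <- & <- & Hu). simpl in Hv; subst v.
  exists u, (cseq C D l). repeat split; auto.
  exists (cc C D), (num C D j). now repeat split.
Qed.

Lemma denotes_dot rho x a y l :
  denotes C rho x a -> denotes C rho y (cseq C D l) ->
  denotes C rho (dot_ x y) (cseq C D (a :: l)).
Proof.
  intros Hx Hy.
  destruct (cd_value C D a l) as (u & v & Hu & Hv & H).
  destruct Hu as (u1 & u2 & <- & <- & Hu). simpl in Hv; subst v.
  exists u, (cseq C D l). repeat split; auto.
  exists (cd C D), a. now repeat split.
Qed.

Lemma K2_app_denotes a b : denotes C [] (apps K2_M [a; b]) (K2_app a b).
Proof.
  destruct (abs_defined C D 2 (App (Var 0) (dot_ (Var 1) (Var 2))) [a; b])
    as [v Hv]; [simpl; lia|reflexivity|].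
  fold K2_M in Hv. unfold K2_app. now rewrite (value_denotes _ _ _ Hv).
Qed.

Lemma denotes_mul rho x a y b :
  denotes C rho x a -> denotes C rho y b ->
  denotes C rho (mul_ x y) (K2_app a b).
Proof.
  intros Hx Hy.
  destruct (K2_app_denotes a b) as (u & v & Hu & Hv & H).
  destruct Hu as (u1 & u2 & <- & <- & Hu). simpl in Hv; subst v.
  exists u, b. repeat split; auto.
  exists K2_M, a. now repeat split.
Qed.

Lemma K2_cont_denotes (p : K2_stack) :
  papp C K2_kappa (proj1_sig p) (K2_cont p).
Proof.
  destruct (abs_defined C D 1 (App (at_ 0 (Var 1)) (Var 0)) [proj1_sig p])
    as [v Hv]; [simpl; lia|reflexivity|].
  fold K2_kappa in Hv. unfold K2_cont. rewrite (value_denotes _ _ _ Hv).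
  destruct Hv as (u & w & <- & <- & H). exact H.
Qed.

Lemma abs1_papp t a v :
  vars_below 1 t -> denotes C [a] t v -> papp C (abs C D 1 t) a v.
Proof.
  intros Ht H.
  destruct (abs_value C D 0 t [a] v Ht eq_refl H) as (u & w & <- & <- & Hv).
  exact Hv.
Qed.

Local Ltac split_rec :=
  simpl; repeat split; auto using cb_recursive, cc_recursive, cd_recursive,
    num_recursive; try lia.

Lemma K2_M_recursive : recursive K2_M.
Proof. apply abs_recursive; split_rec. Qed.

Lemma K2_kappa_recursive : recursive K2_kappa.
Proof. apply abs_recursive; split_rec. Qed.

Lemma K2_app_papp a b p l v :
  proj1_sig p = cseq C D l -> papp C a (proj1_sig (K2_push b p)) v ->
  papp C (K2_app a b) (proj1_sig p) v.
Proof.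
  intros Hp H. rewrite (K2_push_cseq b p l Hp) in H. rewrite Hp.
  destruct (abs_value C D 2 (App (Var 0) (dot_ (Var 1) (Var 2)))
              [a; b; cseq C D l] v) as (u & w & Hu & <- & Hv).
  - simpl; lia.
  - reflexivity.
  - exists a, (cseq C D (b :: l)). repeat split; auto.
    now apply denotes_dot.
  - now rewrite (denotes_fun _ _ _ _ _ (K2_app_denotes a b) Hu).
Qed.

Definition K2_krivine (U : K2 -> Prop) : krivine_structure.
Proof.
  refine {| lam := K2;
            stack := K2_stack;
            kapp := K2_app;
            push := K2_push;
            kcont := K2_cont;
            combK := K2_K;
            combS := K2_S;
            callcc := K2_cc;
            QP := recursive;
            pole := K2_pole U |}.
  - apply abs_recursive; split_rec.
  - apply abs_recursive; split_rec; apply K2_M_recursive.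
  - apply abs_recursive; split_rec; apply K2_kappa_recursive.
  - intros a b Ha Hb.
    destruct (K2_app_denotes a b) as (u & w & Hu & <- & H).
    destruct Hu as (u1 & u2 & <- & <- & Hu).
    apply (recursive_papp _ _ _ _) in Hu; auto using K2_M_recursive.
    now apply (recursive_papp _ _ _ _) in H.
  - intros a b p (u & H & Hu). exists u. split; auto.
    destruct (proj2_sig p) as [l Hl]. now apply (K2_app_papp a b p l).
  - intros t s p (u & H & Hu). exists u. split; auto.
    destruct (proj2_sig p) as [l Hl].
    rewrite (K2_push_cseq _ _ _ (K2_push_cseq _ _ _ Hl)).
    apply abs1_papp; [split_rec|].
    exists t, (cseq C D l). split; [|split].
    + eapply denotes_at; reflexivity.
    + apply (denotes_from _ 2 _ (t :: s :: l)); simpl; auto; [discriminate|lia].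
    + now rewrite <- Hl.
  - intros t s v p (u & H & Hu). exists u. split; auto.
    destruct (proj2_sig p) as [l Hl].
    rewrite (K2_push_cseq _ _ _ (K2_push_cseq _ _ _ (K2_push_cseq _ _ _ Hl))).
    apply abs1_papp; [split_rec|].
    exists (K2_app (K2_app t v) (K2_app s v)), (cseq C D l). split; [|split].
    + repeat apply denotes_mul; eapply denotes_at; reflexivity.
    + apply (denotes_from _ 3 _ (t :: s :: v :: l)); simpl; auto;
        [discriminate|lia].
    + now rewrite <- Hl.
  - intros t p (u & H & Hu). exists u. split; auto.
    destruct (proj2_sig p) as [l Hl].
    rewrite (K2_push_cseq _ _ _ Hl) in H. rewrite (K2_push_cseq _ _ _ Hl).
    apply abs1_papp; [split_rec|].
    assert (Hf : denotes C [cseq C D (t :: l)] (from_ 1 (Var 0)) (cseq C D l)).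
    { apply (denotes_from _ 1 _ (t :: l)); simpl; auto; [discriminate|lia]. }
    exists t, (cseq C D (K2_cont p :: l)). split; [|split].
    + eapply denotes_at; reflexivity.
    + apply denotes_dot; [|exact Hf].
      exists K2_kappa, (cseq C D l). repeat split; [exact Hf|].
      rewrite <- Hl. apply K2_cont_denotes.
    + exact H.
  - intros t p q (u & H & Hu). exists u. split; auto.
    destruct (proj2_sig q) as [l Hl].
    rewrite (K2_push_cseq _ _ _ Hl).
    destruct (abs_value C D 1 (App (at_ 0 (Var 1)) (Var 0))
                [proj1_sig p; cseq C D (t :: l)] u) as (k & w & Hk & <- & Hv).
    + simpl; lia.
    + reflexivity.
    + exists t, (proj1_sig p). repeat split; auto.
      eapply denotes_at; reflexivity.
    + destruct Hk as (k1 & k2 & <- & <- & Hk).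
      now rewrite (papp_fun _ _ _ _ _ (K2_cont_denotes p) Hk).
Defined.

End KrivineK2.

(* Main.v *)
From Stdlib Require Import Arith Lia List Wf_nat.
Require Import Defs.
Import ListNotations.

(** Why the theorem holds.

    In a localic tripos a predicate which is pointwise true is uniformly true.
    Apply this to the family of truth values determined by the single
    quasi-proofs: each of them is true, so if the tripos is localic there is one
    quasi-proof [t] that does the work of all of them at once, i.e. every
    stack accepted by some quasi-proof is accepted by [t]
    ([localic_universal]).  For K2 this says: whenever some recursive function
    sends a stack [p] into [U], the recursive function [t] sends [p] into [U].

    Discreteness of [U] refutes such a [t].  Let [g] be the recursive function
    [<x>t[x]], fix [u] in [U], and consider the sequences obtained from
    [S o u] by putting a finite word in front.  A recursive shift recovers
    [u] from any of them, so [g] sends all of them into [U].  Let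
    [v = g (S o u)].  As [v] is isolated in [U] and [g] is continuous, there is
    a finite initial segment [tau] of [S o u] such that [g] sends every such
    sequence extending [tau] to [v] itself ([universal_locally_constant]).
    These sequences are dense in the open set of extensions of [tau]; hence
    whatever value [g] computes at [n] from a finite word extending [tau] is
    [v n], and [v] is computed by searching for such a word
    ([recursive_of_dense_value]).  So [v] is a recursive element of [U]. *)

(** * Localic triposes have a universal quasi-proof *)

(** The points of an index set separate the order of [H^I], and an equivalence
    transports this back along reindexing over one-point sets. *)
Lemma localic_pointwise (P : indexed_preorder) (I : Type) (x y : P I) :
  localic P ->
  (forall i : I, fle P unit (reindex P I unit (fun _ => i) x)
                            (reindex P I unit (fun _ => i) y)) ->
  fle P I x y.
Proof.
  intros (H & F & G & HGF & _) Hxy.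
  apply fle_trans with (G I (F I x)); [apply HGF|].
  apply fle_trans with (G I (F I y)); [|apply HGF].
  apply imap_mono. intros i.
  destruct (imap_natural _ _ F I unit (fun _ => i) x) as [_ Hx].
  destruct (imap_natural _ _ F I unit (fun _ => i) y) as [Hy _].
  pose proof (imap_mono _ _ F unit _ _ (Hxy i)) as Hi.
  specialize (Hx tt). specialize (Hy tt). specialize (Hi tt).
  simpl in Hx, Hy, Hi.
  eapply lle_trans; [exact Hx|]. eapply lle_trans; [exact Hi|exact Hy].
Qed.

(** The family indexed by the quasi-proofs [r] with value the truth value
    generated by [r] is pointwise above the top element, which has every term
    as a realizer; a realizer of the uniform inequality applied to an arbitrary
    quasi-proof is the required [t]. *)
Lemma localic_universal (A : krivine_structure) :
  localic (krivine_tripos A) ->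
  exists t, QP A t /\ forall r p, QP A r -> pole A r p -> pole A t p.
Proof.
  intros Hloc.
  set (I := {r : lam A | QP A r}).
  set (top := closure A (fun _ => False)).
  set (phi := fun r : I => closure A (orth_terms A (eq (proj1_sig r)))).
  assert (Htop : forall s, orth_stacks A top s).
  { intros s. apply orth_biorth. intros p []. }
  assert (Hle : tripos_le A I (fun _ => top) phi).
  { apply (localic_pointwise (krivine_tripos A) I (fun _ => top) phi Hloc).
    intros [r Hr]. simpl.
    apply (tripos_le_of_realizer A _ _ _ (kapp A (combK A) r)).
    - apply QP_app; [apply QP_K|exact Hr].
    - intros _ s p _ Hp. apply pole_app, pole_K.
      apply Hp. intros q Hq. now apply Hq. }
  destruct Hle as (alpha & (t & Ht & Qt) & Hle).
  exists (kapp A t (combK A)). split; [apply QP_app; auto using QP_K|].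
  intros r p Hr Hp.
  apply (bullet_realizer A alpha top); auto.
  apply (Hle (exist _ r Hr)). apply biorth_incl. now intros s <-.
Qed.

(** * Initial segments and continuity *)

Lemma initial_ext (a b : K2) n :
  initial a n = initial b n <-> forall i, i < n -> a i = b i.
Proof.
  unfold initial. split.
  - intros H i Hi. apply (ext_in_map H). apply in_seq. lia.
  - intros H. apply map_ext_in. intros i Hi. apply H.
    apply in_seq in Hi. lia.
Qed.

Lemma initial_length (a : K2) n : length (initial a n) = n.
Proof. unfold initial. now rewrite length_map, length_seq. Qed.

Lemma nth_initial (a : K2) n i d : i < n -> nth i (initial a n) d = a i.
Proof.
  intros Hi. unfold initial.
  rewrite (nth_indep _ d (a 0)) by now rewrite length_map, length_seq.
  now rewrite map_nth, seq_nth.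
Qed.

Definition prepend (l : list nat) (a : K2) : K2 :=
  fun i => nth i l (a (i - length l)).

Lemma basic_open_nth l (a : K2) :
  basic_open l a <-> forall i, i < length l -> a i = nth i l 0.
Proof.
  unfold basic_open. split.
  - intros H i Hi. rewrite <- H. now rewrite nth_initial.
  - intros H. apply (nth_ext _ _ 0 0); [apply initial_length|].
    rewrite initial_length. intros i Hi. rewrite nth_initial; auto.
Qed.

Lemma basic_open_prepend l (a : K2) : basic_open l (prepend l a).
Proof. apply basic_open_nth. intros i Hi. now apply nth_indep. Qed.

Lemma basic_open_app l l' (a : K2) : basic_open (l ++ l') a -> basic_open l a.
Proof.
  rewrite !basic_open_nth. intros H i Hi.
  rewrite H by (rewrite length_app; lia). now apply app_nth1.
Qed.

Lemma papp_continuous C (g a v : K2) :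
  papp C g a v -> forall k, exists N, forall b w,
    initial b N = initial a N -> papp C g b w -> initial w k = initial v k.
Proof.
  intros Hv. induction k as [|k [N IH]]; [now exists 0|].
  destruct (Hv k) as (M & HM & HlM).
  exists (Nat.max N M). intros b w Hb Hw. rewrite initial_ext in Hb.
  assert (HbM : forall l, l <= M -> initial b l = initial a l).
  { intros l Hl. apply initial_ext. intros i Hi. apply Hb. lia. }
  rewrite !initial_S. f_equal.
  - apply (IH b); auto. apply initial_ext. intros i Hi. apply Hb. lia.
  - f_equal. destruct (Hw k) as (M' & HM' & HlM').
    destruct (lt_eq_lt_dec M M') as [[HMM|<-]|HMM].
    + specialize (HlM' _ HMM). rewrite HbM in HlM' by lia. lia.
    + rewrite HbM in HM' by lia. lia.
    + specialize (HlM _ HMM). rewrite HbM in HM' by lia. lia.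
Qed.

Lemma discrete_isolated (U : K2 -> Prop) v :
  discrete_subspace U -> U v ->
  exists k, forall w, U w -> initial w k = initial v k -> w = v.
Proof.
  intros HU Hv. destruct (HU (eq v)) as (O & HO & Heq).
  { now intros a <-. }
  destruct (HO v) as (sigma & Hs & Hsub); [now apply Heq|].
  exists (length sigma). intros w Hw Hwv. symmetry. apply Heq.
  split; [|exact Hw]. apply Hsub. unfold basic_open. now rewrite Hwv.
Qed.

(** * Programs *)

Lemma computes_constant k : exists z, forall v, computes z v k.
Proof.
  induction k as [|k [z IH]].
  - exists Zero. constructor.
  - exists (Comp Succ [z]). intros v.
    econstructor; [repeat constructor; apply IH|constructor].
Qed.

Definition is_zero : prog := Prec (Comp Succ [Zero]) Zero.

Lemma computes_is_zero k :
  computes is_zero [k] (match k with 0 => 1 | S _ => 0 end).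
Proof.
  induction k as [|k IH].
  - apply computes_prec0. econstructor; [repeat constructor|constructor].
  - eapply computes_precS; [exact IH|constructor].
Qed.

Lemma recursive_pred : recursive pred.
Proof.
  exists (Prec Zero (Proj 0)). induction n as [|n IH].
  - apply computes_prec0. constructor.
  - eapply computes_precS; [exact IH|now constructor].
Qed.

(** [Mu] looks for a zero, and it is searching for nonzero values that is
    needed here: an element of K2 signals its answers by nonzero values. *)
Definition search (p : prog) : prog := Mu (Comp is_zero [p]).

Lemma computes_search p v (w : nat -> nat) e :
  (forall x, computes p (x :: v) (w x)) -> w e <> 0 ->
  exists y, computes (search p) v y /\ w y <> 0 /\ forall x, x < y -> w x = 0.
Proof.
  intros Hp He.
  destruct (dec_inh_nat_subset_has_unique_least_element (fun x => w x <> 0))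
    as (y & [Hy Hmin] & _).
  { intros x. lia. }
  { now exists e. }
  assert (Hlt : forall x, x < y -> w x = 0).
  { intros x Hx. destruct (Nat.eq_dec (w x) 0) as [|Hn]; [assumption|].
    apply Hmin in Hn. lia. }
  exists y. repeat split; auto.
  assert (Hz : forall x, computes (Comp is_zero [p]) (x :: v)
                 (match w x with 0 => 1 | S _ => 0 end)).
  { intros x. econstructor; [|apply computes_is_zero].
    repeat constructor. apply Hp. }
  constructor.
  - specialize (Hz y). now destruct (w y).
  - intros x Hx. exists 0. specialize (Hz x). now rewrite (Hlt x Hx) in Hz.
Qed.

Lemma computes_prepend l p (f : nat -> K2) :
  (forall e i, computes p [i; e] (f e i)) ->
  exists q, forall e i, computes q [i; e] (prepend l (f e) i).
Proof.
  intros Hp. induction l as [|x l [q IH]].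
  - exists p. intros e i. unfold prepend. simpl.
    destruct i; apply Hp.
  - destruct (computes_constant x) as [z Hz].
    exists (Prec z (Comp q [Proj 0; Proj 2])). intros e.
    induction i as [|i IHi].
    + apply computes_prec0, Hz.
    + eapply computes_precS; [exact IHi|].
      econstructor; [|exact (IH e i)]. repeat constructor.
Qed.

Lemma computes_code_initial (C : seq_coding) p (f : nat -> K2) :
  (forall e i, computes p [i; e] (f e i)) ->
  exists q, forall e n l, computes q [l; e; n] (C (n :: initial (f e) l)).
Proof.
  intros Hp. destruct (code_snoc C) as (snoc & [r Hr] & Hsnoc).
  destruct (computes_constant (C [])) as [z Hz].
  exists (Prec (Comp r [z; Proj 1]) (Comp r [Proj 1; Comp p [Proj 0; Proj 2]])).
  intros e n. induction l as [|l IH].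
  - apply computes_prec0.
    change (n :: initial (f e) 0) with ([] ++ [n]). rewrite Hsnoc.
    econstructor; [|apply Hr]. repeat constructor. apply Hz.
  - eapply computes_precS; [exact IH|].
    rewrite initial_S, app_comm_cons, Hsnoc.
    econstructor; [|apply Hr].
    repeat constructor. econstructor; [|apply Hp]. repeat constructor.
Qed.

(** * Recursive elements of K2 *)

(** The value [g] computes at [n] from any finite word extending [tau] is [v n],
    because that word extends to a sequence that [g] sends to [v]; and some
    such word yields a value.  So [v] is computable by unbounded search. *)
Lemma recursive_of_dense_value (C : seq_coding) (g v : K2) tau :
  recursive g ->
  (forall rho, exists a, basic_open (tau ++ rho) a /\ papp C g a v) ->
  recursive v.
Proof.
  intros [pg Hg] Hdense.
  destruct (code_entry C) as (entry & [pe He] & Hentry).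
  (* Every number [e] is read as a sequence extending [tau], followed up to
     length [entry e 0]; all finite words extending [tau] arise this way. *)
  set (a := fun e => prepend tau (fun i => entry e (S i))).
  set (W := fun e n l => g (C (n :: initial (a e) l))).
  destruct (computes_prepend tau (Comp pe [Proj 1; Comp Succ [Proj 0]])
              (fun e i => entry e (S i))) as [pa Ha].
  { intros e i. econstructor; [|apply He].
    repeat constructor. econstructor; repeat constructor. }
  destruct (computes_code_initial C pa a Ha) as [pc Hc].
  set (pW := Comp pg [pc]).
  assert (HW : forall e n l, computes pW [l; e; n] (W e n l)).
  { intros e n l. econstructor; [|apply Hg]. repeat constructor. apply Hc. }
  assert (Hsome : forall n, exists e, W e n (entry e 0) <> 0).
  { intros n. destruct (Hdense []) as (b & Hb & Hv). rewrite app_nil_r in Hb.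
    destruct (Hv n) as (l & Hl & _).
    exists (C (l :: initial (fun i => b (length tau + i)) l)).
    unfold W. rewrite Hentry. simpl (nth 0 _ 0).
    set (e := C (l :: _)).
    replace (initial (a e) l) with (initial b l); [lia|].
    apply initial_ext. intros i Hi. unfold a, prepend.
    rewrite basic_open_nth in Hb.
    destruct (Nat.lt_ge_cases i (length tau)) as [Hlt|Hge].
    - rewrite Hb by assumption. now apply nth_indep.
    - rewrite nth_overflow by assumption. unfold e. rewrite Hentry.
      simpl. rewrite nth_initial by lia. f_equal. lia. }
  (* Only the least nonzero answer counts as the value of an application. *)
  assert (Hval : forall e n l, W e n l <> 0 ->
            (forall k, k < l -> W e n k = 0) -> W e n l = v n + 1).
  { intros e n l Hl Hmin.
    destruct (Hdense (initial (fun i => entry e (S i)) l)) as (b & Hb & Hv).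
    assert (Hba : forall k, k <= l -> initial b k = initial (a e) k).
    { intros k Hk. apply initial_ext. intros i Hi.
      rewrite basic_open_nth in Hb.
      rewrite Hb by (rewrite length_app, initial_length; lia).
      unfold a, prepend.
      destruct (Nat.lt_ge_cases i (length tau)) as [Hlt|Hge].
      - rewrite app_nth1 by assumption. now apply nth_indep.
      - rewrite app_nth2, nth_initial by lia. now rewrite nth_overflow. }
    destruct (Hv n) as (m & Hm & Hmmin). unfold W in *.
    destruct (lt_eq_lt_dec l m) as [[Hlm|<-]|Hlm].
    - specialize (Hmmin _ Hlm). rewrite Hba in Hmmin by lia. contradiction.
    - now rewrite <- Hba.
    - specialize (Hmin _ Hlm). rewrite Hba in Hm by lia. lia. }
  destruct recursive_pred as [pp Hpp].
  set (pE := Comp pW [Comp pe [Proj 0; Zero]; Proj 0; Proj 1]).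
  set (pL := Comp (search pW) [search pE; Proj 0]).
  exists (Comp pp [Comp pW [pL; search pE; Proj 0]]).
  intros n. destruct (Hsome n) as [e0 He0].
  destruct (computes_search pE [n] (fun e => W e n (entry e 0)) e0)
    as (e & HE & Hne & _); [|exact He0|].
  { intros e. econstructor; [|apply HW]. repeat constructor.
    econstructor; [|apply He]. repeat constructor. }
  destruct (computes_search pW [e; n] (W e n) (entry e 0) (HW e n) Hne)
    as (l & HL & Hnl & Hmin).
  replace (v n) with (pred (W e n l)).
  2: { rewrite (Hval e n l Hnl Hmin). lia. }
  econstructor; [|apply Hpp].
  repeat constructor. econstructor; [|apply HW].
  apply Forall2_cons.
  - econstructor; [|exact HL].
    apply Forall2_cons; [exact HE|repeat constructor].
  - apply Forall2_cons; [exact HE|repeat constructor].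
Qed.

(** Taking successors turns the padding value [0] of [nth], which is what is
    read beyond the known part of the argument, into the answer [0] with which
    an element of K2 asks for more of its argument. *)
Lemma recursive_shift (C : seq_coding) m :
  exists h, recursive h /\ forall l u, length l = m ->
    papp C h (prepend l (fun n => S (u n))) u.
Proof.
  destruct (code_entry C) as (entry & [pe He] & Hentry).
  exists (fun x => entry x (S m + entry x 0)). split.
  - assert (Hadd : forall k, exists p, forall x,
              computes p [x] (k + entry x 0)).
    { induction k as [|k [p IH]].
      - exists (Comp pe [Proj 0; Zero]). intros x.
        econstructor; [|apply He]. repeat constructor.
      - exists (Comp Succ [p]). intros x.
        econstructor; [repeat constructor; apply IH|constructor]. }
    destruct (Hadd (S m)) as [p Hp].
    exists (Comp pe [Proj 0; p]). intros x.
    econstructor; [|apply He]. repeat constructor. apply Hp.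
  - intros l u Hl n. exists (S (m + n)). rewrite !Hentry. cbn [nth Nat.add]. split.
    + rewrite nth_initial by lia. unfold prepend.
      rewrite nth_overflow by lia. rewrite Nat.add_1_r. do 2 f_equal. lia.
    + intros k Hk. rewrite !Hentry. cbn [nth Nat.add].
      apply nth_overflow. rewrite initial_length. lia.
Qed.

(** * A universal quasi-proof is locally constant *)

Section Universal.
Context (C : seq_coding) (D : combinators C) (U : K2 -> Prop) (t : K2).
Context (t_universal : forall r p,
  recursive r -> K2_pole C D U r p -> K2_pole C D U t p).

Definition on_singleton : K2 :=
  abs C D 1 (App (Cst t) (App (Cst (ct C D)) (Var 0))).

Lemma on_singleton_recursive : recursive t -> recursive on_singleton.
Proof.
  intros Ht. apply abs_recursive; simpl; auto using ct_recursive.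
Qed.

Lemma on_singleton_prepend u l :
  U u -> exists w,
    papp C on_singleton (prepend l (fun n => S (u n))) w /\ U w.
Proof.
  intros Hu. destruct (recursive_shift C (length l)) as (h & Hh & Hshift).
  set (a := prepend l (fun n => S (u n))).
  set (r := abs C D 1 (App (Cst h) (at_ C D 0 (Var 0)))).
  destruct (t_universal r (exist _ (cseq C D [a]) (ex_intro _ [a] eq_refl)))
    as (w & Hw & HUw).
  - apply abs_recursive; simpl; auto using cb_recursive, num_recursive.
  - exists u. split; [|exact Hu]. apply abs1_papp; [simpl; auto|].
    exists h, a. repeat split.
    + eapply denotes_at; reflexivity.
    + now apply Hshift.
  - exists w. split; [|exact HUw]. apply abs1_papp; [simpl; auto|].
    destruct (ct_value C D a) as (x & y & <- & <- & Hct).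
    exists t, (cseq C D [a]). repeat split; auto.
    exists (ct C D), a. now repeat split.
Qed.

(** The value at [S o u] is isolated in [U], so continuity forces the same value
    on all nearby sequences whose value is in [U]. *)
Lemma universal_locally_constant u :
  discrete_subspace U -> U u ->
  exists v tau, U v /\ forall rho, exists a,
    basic_open (tau ++ rho) a /\ papp C on_singleton a v.
Proof.
  intros HU Hu.
  destruct (on_singleton_prepend u [] Hu) as (v & Hv & HUv).
  destruct (discrete_isolated U v HU HUv) as [k Hk].
  set (center := prepend [] (fun n => S (u n))) in *.
  destruct (papp_continuous C _ _ _ Hv k) as [N HN].
  exists v, (initial center N). split; [exact HUv|]. intros rho.
  destruct (on_singleton_prepend u (initial center N ++ rho) Hu)
    as (w & Hw & HUw).
  pose proof (basic_open_prepend (initial center N ++ rho)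
                (fun n => S (u n))) as Hopen.
  exists (prepend (initial center N ++ rho) (fun n => S (u n))).
  split; [exact Hopen|].
  rewrite <- (Hk w HUw); [exact Hw|].
  apply (HN _ _) in Hw; [exact Hw|].
  apply basic_open_app in Hopen. unfold basic_open in Hopen.
  now rewrite initial_length in Hopen.
Qed.

End Universal.

(** * Non-localicness *)

Theorem theorem2p12 (C : seq_coding) (D : combinators C) (U : K2 -> Prop)
    (U_inhabited : exists u, U u)
    (U_nonrecursive : forall u, U u -> ~ recursive u)
    (U_discrete : discrete_subspace U) :
  ~ localic (krivine_tripos (K2_krivine C D U)).
Proof.
  intros Hloc. destruct U_inhabited as [u Hu].
  destruct (localic_universal _ Hloc) as (t & Ht & Huniv).
  destruct (universal_locally_constant C D U t Huniv u U_discrete Hu)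
    as (v & tau & HUv & Hdense).
  apply (U_nonrecursive v HUv).
  apply (recursive_of_dense_value C (on_singleton C D t) v tau); auto.
  now apply on_singleton_recursive.
Qed.
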